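(* Let $f$ be a deterministic decision tree of depth $d$ over $m$ variables $x_1,\dots,x_m$, viewed as a Boolean function $f:\{-1,1\}^m\to\{-1,1\}$. Then for every $\ell\in\{0,1,\dots,d\}$, $$L_{1,\ell}(f)=\sum_{S\subseteq[m]:|S|=\ell}|\hat f(S)|\ \le\ \sqrt{O(d)^{\ell}\cdot O(\log m)^{\ell-1}},$$ where the $O(\cdot)$ hide universal constants.
   Context: Every $f:\{-1,1\}^m\to\mathbb R$ has a unique Fourier expansion $f(x)=\sum_{S\subseteq[m]}\hat f(S)\prod_{i\in S}x_i$ with $\hat f(S)=\mathbb E_{x\sim\{-1,1\}^m}[f(x)\prod_{i\in S}x_i]$ ($x$ uniform).
   Formalization: The case ℓ = 0 is excluded (1 ≤ ℓ ≤ d is assumed): there the stated bound is sqrt(1/O(log m)), which fails for a constant tree, where L_{1,0}(f) = 1, once m is large. *)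

(* Defs.v *)
From mathcomp Require Import all_boot all_order all_algebra.
From mathcomp Require Import all_classical all_reals all_analysis.
Set Implicit Arguments. Unset Strict Implicit. Unset Printing Implicit Defensive.
Import Order.TTheory GRing.Theory Num.Theory.
Local Open Scope ring_scope.

(* Deterministic decision trees over m Boolean variables x_0..x_{m-1}.
   An input is x : {ffun 'I_m -> bool}; the bit b encodes the value
   (-1)^b in {-1,1}, i.e. true <-> -1, false <-> +1. *)
Inductive dtree (m : nat) : Type :=
  | Leaf of bool                                  (* output (-1)^b *)
  | Node of 'I_m & dtree m & dtree m.             (* query x_i; left if x_i = +1, right if x_i = -1 *)

Fixpoint depth (m : nat) (t : dtree m) : nat :=
  match t with
  | Leaf _ => 0
  | Node _ t0 t1 => (maxn (depth t0) (depth t1)).+1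
  end.

Fixpoint eval_bit (m : nat) (t : dtree m) (x : {ffun 'I_m -> bool}) : bool :=
  match t with
  | Leaf b => b
  | Node i t0 t1 => if x i then eval_bit t1 x else eval_bit t0 x
  end.

Definition sgn (R : ringType) (b : bool) : R := if b then -1 else 1.

Definition dt_fun (R : ringType) (m : nat) (t : dtree m)
  (x : {ffun 'I_m -> bool}) : R := sgn R (eval_bit t x).

Definition fourier (R : fieldType) (m : nat) (f : {ffun 'I_m -> bool} -> R)
  (S : {set 'I_m}) : R :=
  (2 ^+ m)^-1 * \sum_(x : {ffun 'I_m -> bool}) f x * \prod_(i in S) sgn R (x i).

Definition L1_level (R : numFieldType) (m : nat) (f : {ffun 'I_m -> bool} -> R)
  (l : nat) : R :=
  \sum_(S : {set 'I_m} | #|S| == l) `|fourier f S|.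

(* Main.v *)
Require Import Defs.
From mathcomp Require Import all_boot all_order all_algebra.
From mathcomp Require Import all_classical all_reals all_analysis.
From mathcomp Require Import fintype finset ring lra.
Set Implicit Arguments. Unset Strict Implicit. Unset Printing Implicit Defensive.
Import Order.TTheory GRing.Theory Num.Theory.
Local Open Scope ring_scope.

(* Let Q_j(x) be the set of the first j variables queried on input x.  Only
   inputs whose path queries all of S contribute to the Fourier coefficient at
   S, so the level-l mass is at most the mean of |M_d|, where M_j is the sum of
   a_S chi_S over the S of size l inside Q_j and the a_S are signs.  The M_j
   form a martingale whose increment is +-1 times a sum of the same kind at
   level l - 1, with coefficients a_(S u {v}) for the queried variable v.  A
   two-point inequality and convexity bound the 2k-th moment of M_j by (4kj)^k
   times the largest 2k-th moment of an increment; a union bound over v costs a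
   factor m, which is at most 2^k for k of order log m.  Iterating over the
   levels, with second moments at the last one, gives the theorem. *)

(** * Convexity and two-point inequalities for powers *)

Section Inequalities.
Variable R : realFieldType.
Implicit Types (a b y t : R) (k n : nat).

(** The left side is the tangent at [t] to a convex power. Multiplying by [y] in the induction
    leaves the gap [k.+1%:R * t ^+ k * (y - t) ^+ 2]. *)
Lemma expr_ge_tangent k y t : 0 <= y -> 0 <= t ->
  k.+1%:R * t ^+ k * y - k%:R * t ^+ k.+1 <= y ^+ k.+1.
Proof.
move=> y0 t0; elim: k => [|k IHk].
  by rewrite expr0 !expr1 !mul1r mul0r subr0.
have := ler_wpM2l y0 IHk; rewrite -exprS; apply: le_trans.
have : 0 <= k.+1%:R * t ^+ k * (y - t) ^+ 2.
  by rewrite mulr_ge0 ?sqr_ge0 // mulr_ge0 ?exprn_ge0.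
rewrite -subr_ge0 => H; rewrite -subr_ge0; apply: le_trans H _.
by rewrite subr0 le_eqVlt; apply/orP; left; apply/eqP; rewrite !exprS -!natr1; ring.
Qed.

Lemma expr_convex_sum (I : finType) (w y : I -> R) k :
  (forall i, 0 <= w i) -> (forall i, 0 <= y i) -> \sum_i w i = 1 ->
  (\sum_i w i * y i) ^+ k.+1 <= \sum_i w i * y i ^+ k.+1.
Proof.
move=> w0 y0 w1; set t := \sum_i w i * y i.
have t0 : 0 <= t by apply: sumr_ge0 => i _; apply: mulr_ge0.
have : \sum_i w i * (k.+1%:R * t ^+ k * y i - k%:R * t ^+ k.+1)
       <= \sum_i w i * y i ^+ k.+1.
  by apply: ler_sum => i _; apply: ler_wpM2l; rewrite ?expr_ge_tangent.
apply: le_trans.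
rewrite (eq_bigr (fun i => k.+1%:R * t ^+ k * (w i * y i)
                           - w i * (k%:R * t ^+ k.+1))); last by move=> i _; ring.
rewrite sumrB -mulr_sumr -/t -mulr_suml w1 exprS -natr1.
by rewrite le_eqVlt; apply/orP; left; apply/eqP; ring.
Qed.

(** Convexity with weights [p / q] and [q^-1] for [p = n.+1], [q = n.+2]; these make the bound in
    [mart_expr_le] pass from [p ^+ k.+1] to exactly [q ^+ k.+1]. *)
Lemma exprD_le k n a b : 0 <= a -> 0 <= b ->
  (a + b) ^+ k.+1
    <= (n.+2%:R / n.+1%:R) ^+ k * a ^+ k.+1 + n.+2%:R ^+ k * b ^+ k.+1.
Proof.
move=> a0 b0.
have p0 : 0 < n.+1%:R :> R by [].
have q1 : n.+2%:R = n.+1%:R + 1 :> R by rewrite natr1.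
have q0 : 0 < n.+2%:R :> R by [].
move: (n.+1%:R) (n.+2%:R) p0 q1 q0 => p q p0 q1 q0.
have pP := ltW p0; have qP := ltW q0.
have pN0 := lt0r_neq0 p0; have qN0 := lt0r_neq0 q0.
pose w (i : bool) := if i then p / q else q^-1.
pose y (i : bool) := if i then q / p * a else q * b.
have := @expr_convex_sum bool w y k.
rewrite !big_bool /w /y /=.
have -> : p / q * (q / p * a) = a by field; rewrite pN0 qN0.
rewrite mulKf // => H; apply: le_trans (H _ _ _) _ => {H}.
- by case; rewrite ?divr_ge0 ?invr_ge0.
- by case; rewrite !mulr_ge0 ?invr_ge0.
- by move: qN0; rewrite q1 => qN0; field.
rewrite le_eqVlt; apply/orP; left; apply/eqP.
by rewrite !exprMn !exprVn !exprS; field; rewrite pN0 qN0 !expf_neq0.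
Qed.

(* With E and O the even and odd parts in b of (a + b)^2k, one has
   E' = (a^2 + b^2) E + 2 a b O and O' = (a^2 + b^2) O + 2 a b E when k grows
   by one, which makes a b O <= 2 k b^2 E inductive. *)
Lemma two_point_expr k a b :
  ((a + b) ^+ (2 * k) + (a - b) ^+ (2 * k)) / 2
    <= (a ^+ 2 + (4 * k)%:R * b ^+ 2) ^+ k.
Proof.
pose e k := ((a + b) ^+ (2 * k) + (a - b) ^+ (2 * k)) / 2.
pose o k := ((a + b) ^+ (2 * k) - (a - b) ^+ (2 * k)) / 2.
have eS j : e j.+1 = (a ^+ 2 + b ^+ 2) * e j + 2 * a * b * o j.
  by rewrite /e /o mulnS !exprD; field.
have oS j : o j.+1 = (a ^+ 2 + b ^+ 2) * o j + 2 * a * b * e j.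
  by rewrite /e /o mulnS !exprD; field.
have e0 j : 0 <= e j.
  by rewrite /e divr_ge0 // addr_ge0 // exprM exprn_ge0 ?sqr_ge0.
have a20 : 0 <= a ^+ 2 by apply: sqr_ge0.
have b20 : 0 <= b ^+ 2 by apply: sqr_ge0.
have ab0 : 0 <= (a * b) ^+ 2 by apply: sqr_ge0.
have o0 j : 0 <= a * b * o j.
  elim: j => [|j IHj]; first by rewrite /o muln0 !expr0 subrr mul0r mulr0.
  have -> : a * b * o j.+1
    = (a ^+ 2 + b ^+ 2) * (a * b * o j) + 2 * ((a * b) ^+ 2 * e j).
    by rewrite oS; ring.
  by rewrite addr_ge0 // mulr_ge0 ?addr_ge0 // mulr_ge0.
have oe j : a * b * o j <= (2 * j)%:R * (b ^+ 2 * e j).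
  elim: j => [|j IHj].
    by rewrite /o muln0 !expr0 subrr mul0r mulr0 mul0r.
  rewrite oS eS.
  have H1 := ler_wpM2l (addr_ge0 a20 b20) IHj.
  have H2 : 0 <= (2 * j.+1)%:R * b ^+ 2 * (2 * (a * b * o j)).
    by apply: mulr_ge0; apply: mulr_ge0.
  have H3 : 0 <= b ^+ 2 * b ^+ 2 * e j := mulr_ge0 (mulr_ge0 b20 b20) (e0 j).
  rewrite mulnS natrD in H2 *.
  move: H1 H2 H3; set c := (2 * j)%:R; set u := e j; set v := o j => H1 H2 H3.
  by rewrite -subr_ge0 in H1; rewrite -subr_ge0; lra.
rewrite -/(e k).
(* The constant [4 * n] is fixed before the induction on the exponent, whose step multiplies [e] by
   at most [a ^+ 2 + (4 * k + 1) * b ^+ 2]. *)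
suff H n : (k <= n)%N -> e k <= (a ^+ 2 + (4 * n)%:R * b ^+ 2) ^+ k by apply: H.
elim: k => [|k IHk] kn; first by rewrite /e muln0 !expr0 divff // pnatr_eq0.
have IH := IHk (ltnW kn); rewrite exprS.
have c0 : 0 <= a ^+ 2 + (4 * n)%:R * b ^+ 2 by rewrite addr_ge0 // mulr_ge0.
apply: le_trans (ler_wpM2l c0 IH); rewrite eS.
have kn' : (4 * k)%:R + 1 <= (4 * n)%:R :> R.
  rewrite natr1 ler_nat; apply: leq_trans (leq_mul (leqnn 4) kn).
  by rewrite mulnS -addn1 addnC leq_add2r.
have H1 := oe k.
have H2 := ler_wpM2r (mulr_ge0 b20 (e0 k)) kn'.
have E4 : (4 * k)%:R = 2 * (2 * k)%:R :> R by rewrite -natrM mulnA.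
rewrite E4 in H2.
move: H1 H2; set c := (2 * k)%:R; set d := (4 * n)%:R.
set u := e k; set v := o k => H1 H2.
by rewrite -subr_ge0 in H1; rewrite -subr_ge0 in H2; rewrite -subr_ge0; lra.
Qed.

End Inequalities.

(** * Averages over the uniform cube *)

Section Average.
Variables (R : realFieldType) (m : nat).
Implicit Types f g : {ffun 'I_m -> bool} -> R.

Definition avg f : R := (2 ^+ m)^-1 * \sum_x f x.

Lemma avg_weight_ge0 : 0 <= (2 ^+ m)^-1 :> R.
Proof. by rewrite invr_ge0 exprn_ge0. Qed.

Lemma eq_avg f g : f =1 g -> avg f = avg g.
Proof. by move=> fg; congr (_ * _); apply: eq_bigr. Qed.

Lemma le_avg f g : (forall x, f x <= g x) -> avg f <= avg g.
Proof.
by move=> fg; rewrite ler_wpM2l ?avg_weight_ge0 // ler_sum.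
Qed.

Lemma avgD f g : avg (fun x => f x + g x) = avg f + avg g.
Proof. by rewrite /avg big_split mulrDr. Qed.

Lemma avgZ (c : R) f : avg (fun x => c * f x) = c * avg f.
Proof. by rewrite /avg -mulr_sumr mulrCA. Qed.

Lemma avg_sum (I : finType) (P : pred I) (F : I -> {ffun 'I_m -> bool} -> R) :
  avg (fun x => \sum_(i | P i) F i x) = \sum_(i | P i) avg (F i).
Proof. by rewrite /avg exchange_big mulr_sumr. Qed.

Lemma sum_avg_weight : \sum_(x : {ffun 'I_m -> bool}) (2 ^+ m)^-1 = 1 :> R.
Proof.
rewrite sumr_const card_ffun card_bool card_ord -[LHS]mulr_natl natrX.
by rewrite mulfV // expf_neq0 // pnatr_eq0.
Qed.

Lemma avg_cst (c : R) : avg (fun=> c) = c.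
Proof.
by rewrite /avg mulr_sumr -mulr_suml sum_avg_weight mul1r.
Qed.

Lemma avg_expr_le f k : (forall x, 0 <= f x) ->
  avg f ^+ k.+1 <= avg (fun x => f x ^+ k.+1).
Proof.
move=> f0; rewrite /avg !mulr_sumr.
by apply: expr_convex_sum; rewrite ?sum_avg_weight // => _; apply: avg_weight_ge0.
Qed.

Lemma avg_reindex (s : {ffun 'I_m -> bool} -> {ffun 'I_m -> bool}) f :
  involutive s -> avg (fun x => f (s x)) = avg f.
Proof.
by move=> sK; rewrite /avg [in RHS](reindex_inj (can_inj sK)).
Qed.

Lemma avg_odd0 (s : {ffun 'I_m -> bool} -> {ffun 'I_m -> bool}) f :
  involutive s -> (forall x, f (s x) = - f x) -> avg f = 0.
Proof.
move=> sK fs; have := avg_reindex f sK.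
rewrite (@eq_avg _ (fun x => -1 * f x)) ?avgZ; last by move=> x; rewrite fs mulN1r.
lra.
Qed.

(* Symmetrising over s turns M + D into the two values M + D and M - D. *)
Lemma avg_even_odd_expr (s : {ffun 'I_m -> bool} -> {ffun 'I_m -> bool})
    (M D : {ffun 'I_m -> bool} -> R) k :
  involutive s -> (forall x, M (s x) = M x) -> (forall x, D (s x) = - D x) ->
  avg (fun x => (M x + D x) ^+ (2 * k))
    <= avg (fun x => (M x ^+ 2 + (4 * k)%:R * D x ^+ 2) ^+ k).
Proof.
move=> sK Ms Ds.
have -> : avg (fun x => (M x + D x) ^+ (2 * k))
  = avg (fun x => ((M x + D x) ^+ (2 * k) + (M x - D x) ^+ (2 * k)) / 2).
  under [RHS]eq_avg => x do rewrite mulrC.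
  rewrite avgZ avgD.
  rewrite -(avg_reindex (fun x => (M x - D x) ^+ (2 * k)) sK).
  under [X in _ + X]eq_avg => x do rewrite Ms Ds opprK.
  by field.
by apply: le_avg => x; apply: two_point_expr.
Qed.

End Average.

(** * Characters and homogeneous polynomials restricted to a set of variables *)

Section RestrictedPolynomial.
Variables (R : realFieldType) (m : nat).
Implicit Types (x : {ffun 'I_m -> bool}) (S Q : {set 'I_m}).
Implicit Types a : {set 'I_m} -> R.

Definition chi S x : R := \prod_(i in S) sgn R (x i).

Definition restr_poly a (l : nat) Q x : R :=
  \sum_(S : {set 'I_m} | (S \subset Q) && (#|S| == l)) a S * chi S x.

Lemma sgn_sqr (b : bool) : sgn R b ^+ 2 = 1.
Proof. by case: b; rewrite /= ?sqrrN expr1n. Qed.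

Lemma sgnN (b : bool) : sgn R (~~ b) = - sgn R b.
Proof. by case: b; rewrite /= ?opprK. Qed.

Lemma eq_chi S x x' : {in S, x =1 x'} -> chi S x = chi S x'.
Proof. by move=> xx'; apply: eq_bigr => i iS; rewrite xx'. Qed.

Lemma chiU1 v S x : v \notin S -> chi (v |: S) x = sgn R (x v) * chi S x.
Proof. by move=> vS; rewrite /chi big_setU1. Qed.

Lemma eq_restr_poly a l Q x x' : {in Q, x =1 x'} ->
  restr_poly a l Q x = restr_poly a l Q x'.
Proof.
move=> xx'; apply: eq_bigr => S /andP[/subsetP SQ _]; congr (_ * _).
by apply: eq_chi => i /SQ; apply: xx'.
Qed.

Lemma restr_poly0 a Q x : restr_poly a 0 Q x = a set0.
Proof.
rewrite /restr_poly (big_pred1 set0) ?/chi ?big_set0 ?mulr1 // => S /=.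
by rewrite cards_eq0; case: eqP => [->|]; rewrite ?sub0set ?andbF.
Qed.

Lemma restr_poly_set0 a l x : restr_poly a l.+1 set0 x = 0.
Proof.
rewrite /restr_poly big1 // => S /andP[].
by rewrite subset0 => /eqP ->; rewrite cards0.
Qed.

(** Sets are split by whether they contain [v]. Those that do are [v |: S] with [S] inside [Q],
    hence the shifted coefficients. *)
Lemma restr_polyU1 a l v Q x : v \notin Q ->
  restr_poly a l.+1 (v |: Q) x
    = restr_poly a l.+1 Q x
      + sgn R (x v) * restr_poly (fun S => a (v |: S)) l Q x.
Proof.
move=> vQ; rewrite /restr_poly (bigID (fun S => v \in S)) /= addrC; congr (_ + _).
  apply: eq_bigl => S; rewrite andbAC; congr (_ && _).
  have [vS|vS] /= := boolP (v \in S).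
    rewrite andbF; apply/esym/negbTE; apply: contra vQ => /subsetP; exact.
  rewrite andbT; apply/subsetP/subsetP => H i iS; last first.
    by rewrite inE H // orbT.
  move/H: (iS); rewrite !inE => /orP[/eqP iv|//].
  by rewrite -iv iS in vS.
rewrite mulr_sumr (reindex_onto (fun S => v |: S) (fun S => S :\ v)) /=; last first.
  by move=> S /andP[_ vS]; rewrite setD1K.
apply: eq_big => [S|S].
  rewrite setU11 andbT.
  have [vS|vS] := boolP (v \in S).
    have -> : (S \subset Q) = false.
      by apply/negbTE; apply: contra vQ => /subsetP; exact.
    apply/negbTE; rewrite negb_and; apply/orP; right.
    by apply: contraTneq vS => <-; rewrite !inE eqxx.
  rewrite setU1K // eqxx andbT cardsU1 vS add1n eqSS; congr (_ && _).
  apply/subsetP/subsetP => H i iS; last first.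
    by move: iS; rewrite !inE => /orP[->//|/H ->]; rewrite orbT.
  have : i \in v |: Q by apply: H; rewrite inE iS orbT.
  by rewrite !inE => /orP[/eqP iv|//]; rewrite -iv iS in vS.
move=> /andP[/andP[_ _] /eqP SE].
have vS : v \notin S by rewrite -SE !inE eqxx.
by rewrite chiU1 // mulrCA.
Qed.

End RestrictedPolynomial.

(** * Query paths, and what a prefix of the path determines *)

Section Queries.
Variable m : nat.
Implicit Types (x : {ffun 'I_m -> bool}) (t : dtree m).

Fixpoint queries t x : seq 'I_m :=
  match t with
  | Leaf _ => [::]
  | Node i t0 t1 => i :: (if x i then queries t1 x else queries t0 x)
  end.

(** A repeated query advances [j] without enlarging the set, so it may have fewer than [j] elements
    even on a long path. *)
Definition first_queries t (j : nat) x : {set 'I_m} :=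
  [set i in take j (queries t x)].

Lemma size_queries t x : (size (queries t x) <= depth t)%N.
Proof.
elim: t => //= i t0 IH0 t1 IH1; rewrite ltnS.
by case: (x i); rewrite leq_max ?IH0 ?IH1 ?orbT.
Qed.

(** The answers to the first [j] queries also fix which variable comes next, hence [j.+1] in the
    conclusion. *)
Lemma take_queries_local t j x x' :
  {in first_queries t j x, x =1 x'} ->
  take j.+1 (queries t x') = take j.+1 (queries t x).
Proof.
elim: t j => [//|i t0 IH0 t1 IH1] [|j] xx' /=; first by rewrite !take0.
have xi : x i = x' i by apply: xx'; rewrite !inE eqxx.
rewrite -xi; congr (_ :: _).
move: xx'; rewrite /first_queries /=.
case: (x i) => xx'; [apply: IH1|apply: IH0] => k;
  by rewrite inE => kQ; apply: xx'; rewrite !inE /= kQ orbT.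
Qed.

Lemma first_queries_local t j x x' :
  {in first_queries t j x, x =1 x'} ->
  first_queries t j x' = first_queries t j x /\
  first_queries t j.+1 x' = first_queries t j.+1 x.
Proof.
move=> /take_queries_local E; rewrite /first_queries E; split=> //.
by rewrite -(take_takel _ (leqnSn j)) E take_takel.
Qed.

Lemma eval_bit_local t x x' :
  {in first_queries t (depth t) x, x =1 x'} -> eval_bit t x' = eval_bit t x.
Proof.
rewrite /first_queries take_oversize ?size_queries //.
elim: t => [//|i t0 IH0 t1 IH1] xx' /=.
have xi : x i = x' i by apply: xx'; rewrite !inE eqxx.
rewrite -xi.
by move: xx' => /=; case: (x i) => xx'; [apply: IH1|apply: IH0] => k;
  rewrite inE => kQ; apply: xx'; rewrite !inE /= kQ orbT.
Qed.

Lemma first_queriesS t j x :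
  first_queries t j.+1 x = first_queries t j x \/
  exists2 v, v \notin first_queries t j x
    & first_queries t j.+1 x = v |: first_queries t j x.
Proof.
have [lej|ltj] := leqP (size (queries t x)) j.
  by left; rewrite /first_queries !take_oversize // (leq_trans lej).
case E: (queries t x) ltj => [//|v0 s] ltj.
have E1 : first_queries t j.+1 x = nth v0 (v0 :: s) j |: first_queries t j x.
  rewrite /first_queries E (take_nth v0) //.
  by apply/setP => i; rewrite !inE mem_rcons !inE.
have [vQ|vQ] := boolP (nth v0 (v0 :: s) j \in first_queries t j x).
  by left; rewrite E1; apply/setUidPr; rewrite sub1set.
by right; exists (nth v0 (v0 :: s) j).
Qed.

Definition flip_on (A : {set 'I_m}) x : {ffun 'I_m -> bool} :=
  [ffun i => x i (+) (i \in A)].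

(** Flips the variable that is new at step [j], if any. The path up to there and the new variable
    itself stay the same, so this is an involution; symmetrising over it stands in for conditional
    expectation. *)
Definition flip_next t j x :=
  flip_on (first_queries t j.+1 x :\: first_queries t j x) x.

Lemma flip_next_agree t j x : {in first_queries t j x, x =1 flip_next t j x}.
Proof. by move=> i iQ; rewrite ffunE in_setD iQ addbF. Qed.

Lemma flip_nextK t j : involutive (flip_next t j).
Proof.
move=> x; have [E E1] := first_queries_local (@flip_next_agree t j x).
rewrite {1}/flip_next E E1.
by apply/ffunP => i; rewrite !ffunE -addbA addbb addbF.
Qed.

End Queries.

(** * Moment bounds for the martingale and for the level mass *)

Section Martingale.
Variables (R : realFieldType) (m : nat) (t : dtree m).
Implicit Types (x : {ffun 'I_m -> bool}) (a : {set 'I_m} -> R).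

Definition mart a l j x : R := restr_poly a l (first_queries t j x) x.

Definition mart_incr a l j x : R := mart a l j.+1 x - mart a l j x.

Lemma mart_flip a l j x : mart a l j (flip_next t j x) = mart a l j x.
Proof.
rewrite /mart (first_queries_local (@flip_next_agree m t j x)).1.
by apply/esym/eq_restr_poly; apply: flip_next_agree.
Qed.

Lemma mart_incrP a l j x :
  (first_queries t j.+1 x = first_queries t j x /\ mart_incr a l.+1 j x = 0) \/
  exists v, [/\ v \notin first_queries t j x,
    first_queries t j.+1 x = v |: first_queries t j x &
    mart_incr a l.+1 j x = sgn R (x v) * mart (fun S => a (v |: S)) l j x].
Proof.
rewrite /mart_incr /mart; case: (first_queriesS t j x) => [->|[v vQ ->]].
  by left; rewrite subrr.
by right; exists v; split=> //; rewrite restr_polyU1 // addrAC subrr add0r.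
Qed.

(** The sign [sgn R (x v)] of the new variable flips, while [v] and the inner polynomial, which
    reads only earlier variables, stay. *)
Lemma mart_incr_flip a l j x :
  mart_incr a l.+1 j (flip_next t j x) = - mart_incr a l.+1 j x.
Proof.
have [E E1] := first_queries_local (@flip_next_agree m t j x).
case: (mart_incrP a l j x) => [[Q1 ->]|[v [vQ Q1 ->]]].
  case: (mart_incrP a l j (flip_next t j x)) => [[_ ->]|[v [vQ Q2 _]]].
    by rewrite oppr0.
  by move: vQ; rewrite E -Q1 -E1 Q2 setU11.
case: (mart_incrP a l j (flip_next t j x)) => [[Q2 _]|[w [wQ Q2 ->]]].
  by move: vQ; rewrite -E -Q2 E1 Q1 setU11.
have -> : w = v.
  have : w \in v |: first_queries t j x by rewrite -Q1 -E1 Q2 setU11.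
  by rewrite inE in_set1 -E (negbTE wQ) orbF => /eqP.
rewrite mart_flip -mulNr -sgnN; congr (sgn R _ * _).
by rewrite ffunE Q1 in_setD setU11 vQ /= addbT.
Qed.

(* The next queried variable may depend on the past; a union bound over its m
   possible values removes this dependence. *)
Lemma mart_incr_expr_le a l j k (B : R) :
  (forall v, avg (fun x => mart (fun S => a (v |: S)) l j x ^+ (2 * k.+1)) <= B) ->
  avg (fun x => mart_incr a l.+1 j x ^+ (2 * k.+1)) <= m%:R * B.
Proof.
move=> HB.
pose F v x := mart (fun S => a (v |: S)) l j x ^+ (2 * k.+1).
have F0 v x : 0 <= F v x by rewrite /F exprM exprn_ge0 ?sqr_ge0.
apply: (@le_trans _ _ (avg (fun x => \sum_v F v x))).
  apply: le_avg => x; case: (mart_incrP a l j x) => [[_ ->]|[v [_ _ ->]]].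
    by rewrite mulnS expr0n /= sumr_ge0.
  rewrite (bigD1 v) //= exprMn (exprM (sgn R _)) sgn_sqr expr1n mul1r.
  by rewrite lerDl sumr_ge0.
rewrite avg_sum; apply: le_trans (ler_sum _ (fun v _ => HB v)) _.
by rewrite sumr_const card_ord mulr_natl.
Qed.

(** Induction on [j]: symmetrise over [flip_next], apply the two-point inequality, then separate old
    value and increment by [exprD_le]. *)
Lemma mart_expr_le a l j k (B : R) : 0 <= B ->
  (forall i, (i < j)%N ->
     avg (fun x => mart_incr a l.+1 i x ^+ (2 * k.+1)) <= B) ->
  avg (fun x => mart a l.+1 j x ^+ (2 * k.+1))
    <= ((4 * k.+1)%:R * j%:R) ^+ k.+1 * B.
Proof.
move=> B0.
have M0 x : mart a l.+1 0 x = 0.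
  have E : first_queries t 0 x = set0.
    by apply/setP => i; rewrite !inE take0.
  by rewrite /mart E restr_poly_set0.
have ME n x : mart a l.+1 n.+1 x = mart a l.+1 n x + mart_incr a l.+1 n x.
  by rewrite /mart_incr addrC subrK.
elim: j => [_|[|n] IHj HB].
- under eq_avg => x do rewrite M0 mulnS expr0n.
  by rewrite avg_cst mulr0 expr0n mul0r.
(* The case [j = 1] is separate because [exprD_le] divides by the previous [j]. *)
- under eq_avg => x do rewrite ME M0 add0r.
  apply: le_trans (HB 0%N isT) _.
  by rewrite mulr1 ler_peMl // exprn_ege1 // ler1n.
have IH := IHj (fun i ij => HB i (ltnW ij)).
have HD := HB n.+1 (leqnn _).
under eq_avg => x do rewrite ME.
apply: le_trans (avg_even_odd_expr k.+1 (flip_nextK t n.+1)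
  (mart_flip a l.+1 n.+1) (mart_incr_flip a l n.+1)) _.
set K : R := (4 * k.+1)%:R in IH *.
have K0 : 0 <= K by [].
have p0 : 0 < n.+1%:R :> R by [].
have q0 : 0 < n.+2%:R :> R by [].
have q1 : n.+2%:R = n.+1%:R + 1 :> R by rewrite natr1.
apply: (@le_trans _ _ (avg (fun x =>
    (n.+2%:R / n.+1%:R) ^+ k * mart a l.+1 n.+1 x ^+ (2 * k.+1)
    + n.+2%:R ^+ k * K ^+ k.+1 * mart_incr a l.+1 n.+1 x ^+ (2 * k.+1)))).
  apply: le_avg => x; apply: le_trans (exprD_le k n _ _) _.
  - exact: sqr_ge0.
  - by rewrite mulr_ge0 ?sqr_ge0.
  by rewrite (exprMn _ K) !(exprM _ 2) mulrA.
rewrite avgD !avgZ.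
move: (n.+1%:R) (n.+2%:R) p0 q0 q1 IH => p q p0 q0 q1 IH.
have pP := ltW p0; have qP := ltW q0; have pN0 := lt0r_neq0 p0.
apply: (@le_trans _ _ ((q / p) ^+ k * ((K * p) ^+ k.+1 * B)
                       + q ^+ k * K ^+ k.+1 * B)).
  apply: lerD; apply: ler_wpM2l => //.
    by rewrite exprn_ge0 ?divr_ge0.
  by rewrite mulr_ge0 ?exprn_ge0.
(* Both terms share [q ^+ k * K ^+ k.+1 * B], with cofactors [p] and [1], and [p + 1 = q]. *)
rewrite le_eqVlt; apply/orP; left; apply/eqP.
rewrite !exprMn exprVn !(exprS p) !(exprS q) {3}q1.
by field; rewrite expf_neq0.
Qed.

(** Induction on [l], for all [a] at once since increments shift the coefficients. Each level costs
    the factor of [mart_expr_le] and an [m] from the union bound. *)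
Lemma mart_moment_le a l j k : (forall S, `|a S| <= 1) ->
  (j <= depth t)%N ->
  avg (fun x => mart a l j x ^+ (2 * k.+1))
    <= (((4 * k.+1)%:R * (depth t)%:R) ^+ k.+1 * m%:R) ^+ l.
Proof.
elim: l a j => [|l IHl] a j a1 jd.
  under eq_avg => x do rewrite /mart restr_poly0.
  rewrite avg_cst exprM -real_normK ?num_real // -exprM.
  exact: exprn_ile1.
set A := _ * m%:R.
have A0 : 0 <= A ^+ l by rewrite exprn_ge0 // mulr_ge0 // exprn_ge0 // mulr_ge0.
apply: le_trans (@mart_expr_le _ _ _ _ (m%:R * A ^+ l) _ _) _.
- by rewrite mulr_ge0.
- move=> i ij; apply: mart_incr_expr_le => v; apply: IHl => //.
  exact: leq_trans (ltnW ij) jd.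
rewrite (exprS A) mulrA ler_wpM2r // /A ler_wpM2r // lerXn2r ?nnegrE ?mulr_ge0 //.
by rewrite ler_wpM2l // ler_nat.
Qed.

(** The top level uses second moments only, so it yields no logarithm; Jensen's inequality passes to
    higher moments of the increments for the [l] lower levels. *)
Lemma mart_sqr_le a l k : (forall S, `|a S| <= 1) -> (m <= 2 ^ k.+1)%N ->
  avg (fun x => mart a l.+1 (depth t) x ^+ 2)
    <= 8 * (depth t)%:R * (8 * (depth t)%:R * k.+1%:R) ^+ l.
Proof.
move=> a1 mk; set d : R := (depth t)%:R.
(* [B] is the [k.+1]-th root of [m * (A * m) ^+ l], with [A] as below, once [m] is replaced by
   [2 ^+ k.+1]. *)
set B : R := 2 * (8 * d * k.+1%:R) ^+ l.
have B0 : 0 <= B by rewrite mulr_ge0 // exprn_ge0 // !mulr_ge0.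
have -> : 8 * d * (8 * d * k.+1%:R) ^+ l = ((4 * 1)%:R * d) ^+ 1 * B.
  by rewrite /B expr1 muln1; ring.
apply: (@mart_expr_le _ _ _ 0) => // i id.
have D0 : 0 <= avg (fun x => mart_incr a l.+1 i x ^+ 2).
  rewrite -(avg_cst m (0 : R)); apply: le_avg => x; exact: sqr_ge0.
rewrite -(@ler_pXn2r _ k.+1) ?nnegrE //.
apply: le_trans (avg_expr_le _ _) _; first by move=> x; apply: sqr_ge0.
under eq_avg => x do rewrite -exprM.
have m2 : m%:R <= 2 ^+ k.+1 :> R by rewrite -natrX ler_nat.
set A := ((4 * k.+1)%:R * d) ^+ k.+1.
have A0 : 0 <= A by rewrite exprn_ge0 // mulr_ge0.
apply: (@le_trans _ _ (m%:R * (A * m%:R) ^+ l)).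
  apply: mart_incr_expr_le => v; apply: mart_moment_le => //; exact: ltnW.
rewrite /B [leRHS]exprMn.
apply: ler_pM => //; first by rewrite exprn_ge0 // mulr_ge0.
rewrite [leRHS]exprAC lerXn2r ?nnegrE ?mulr_ge0 ?exprn_ge0 ?mulr_ge0 //.
apply: le_trans (ler_wpM2l A0 m2) _.
rewrite /A -exprMn natrM le_eqVlt; apply/orP; left; apply/eqP.
by congr (_ ^+ _); ring.
Qed.

(* If S contains an unqueried variable, flipping it changes the sign of chi
   but not the path, so such inputs do not contribute. *)
Lemma fourier_queried (S : {set 'I_m}) :
  fourier (dt_fun R t) S
    = avg (fun x => dt_fun R t x
        * (if S \subset first_queries t (depth t) x then chi R S x else 0)).
Proof.
pose Q x := first_queries t (depth t) x.
(* The choice depends on the input only through [Q x], which [s] preserves; so [s] flips the same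
   variable twice and is an involution. *)
pose A (Q : {set 'I_m}) : {set 'I_m} :=
  if [pick i in S :\: Q] is Some i then [set i] else set0.
pose s x := flip_on (A (Q x)) x.
have sQ x : {in Q x, x =1 s x}.
  move=> i iQ; rewrite ffunE /A; case: pickP => [k|_]; last by rewrite in_set0 addbF.
  rewrite in_setD in_set1 => /andP[kQ _]; case: eqP => [ik|_]; last by rewrite addbF.
  by rewrite -ik iQ in kQ.
have QE x : Q (s x) = Q x by rewrite /Q (first_queries_local (sQ x)).1.
have sK : involutive s.
  by move=> x; apply/ffunP => i; rewrite /s !ffunE QE -addbA addbb addbF.
rewrite -[LHS]/(avg (fun x => dt_fun R t x * chi R S x)).
apply/eqP; rewrite -subr_eq0 -mulN1r -avgZ -avgD; apply/eqP.
apply: (avg_odd0 sK) => x.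
rewrite -/(Q (s x)) -/(Q x) QE /dt_fun (eval_bit_local (sQ x)).
have [SQ|SQ] := boolP (S \subset Q x).
  by rewrite !mulN1r !subrr oppr0.
rewrite !mulr0 !addr0 -mulrN; congr (_ * _).
have : [exists i, i \in S :\: Q x].
  by case/subsetPn: SQ => i iS iQ; apply/existsP; exists i; rewrite in_setD iS iQ.
case/existsP => i0 i0S; rewrite /s /A; case: pickP => [i|/(_ i0)]; last first.
  by rewrite i0S.
rewrite in_setD => /andP[_ iS].
rewrite /chi (bigD1 i) //= [in RHS](bigD1 i) //= ffunE in_set1 eqxx addbT sgnN.
rewrite mulNr; congr (- (_ * _)); apply: eq_bigr => k /andP[_ ki].
by rewrite ffunE in_set1 (negbTE ki) addbF.
Qed.

(** The signs [a] turn the absolute values into the correlation of [dt_fun] with [mart]. As [dt_fun]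
    has modulus 1, Jensen for the square leaves the second moment. *)
Lemma L1_level_sqr_le l k : (m <= 2 ^ k.+1)%N ->
  L1_level (dt_fun R t) l.+1 ^+ 2
    <= 8 * (depth t)%:R * (8 * (depth t)%:R * k.+1%:R) ^+ l.
Proof.
move=> mk; pose a S := Num.sg (fourier (dt_fun R t) S).
have a1 S : `|a S| <= 1 by rewrite /a normr_sg; case: (_ != 0).
apply: le_trans (mart_sqr_le l a1 mk).
have -> : L1_level (dt_fun R t) l.+1
  = avg (fun x => dt_fun R t x * mart a l.+1 (depth t) x).
  transitivity (\sum_(S : {set 'I_m} | #|S| == l.+1) avg (fun x => a S *
      (dt_fun R t x
        * (if S \subset first_queries t (depth t) x then chi R S x else 0)))).
    by apply: eq_bigr => S _; rewrite avgZ -fourier_queried [LHS]normrEsg.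
  rewrite -avg_sum; apply: eq_avg => x; rewrite /mart /restr_poly mulr_sumr.
  rewrite [LHS]big_mkcond [RHS]big_mkcond; apply: eq_bigr => S _.
  by rewrite andbC; case: eqP => //= _; case: ifP => _; rewrite ?mulr0 // mulrCA.
have N0 : 0 <= avg (fun x => `|mart a l.+1 (depth t) x|).
  by rewrite -(avg_cst m (0 : R)); apply: le_avg.
set y := avg _.
have yN : `|y| <= avg (fun x => `|mart a l.+1 (depth t) x|).
  rewrite ler_norml; apply/andP; split.
    rewrite -mulN1r -avgZ; apply: le_avg => x; rewrite mulN1r.
    rewrite /dt_fun; case: (eval_bit t x) => /=; rewrite ?mul1r ?mulN1r ?lerN2.
      exact: ler_norm.
    by rewrite lerNl -normrN ler_norm.
  apply: le_avg => x; rewrite /dt_fun; case: (eval_bit t x) => /=.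
    by rewrite mulN1r -normrN ler_norm.
  by rewrite mul1r ler_norm.
rewrite -real_normK ?num_real //.
apply: (@le_trans _ _ (avg (fun x => `|mart a l.+1 (depth t) x|) ^+ 2)).
  by rewrite lerXn2r ?nnegrE.
apply: le_trans (avg_expr_le 1 _) _ => //.
by apply: le_avg => x; rewrite real_normK ?num_real.
Qed.

End Martingale.

(** * Choice of the moment order and of the constants *)

Theorem mainTheorem4 (R : realType) :
  exists C1 C2 : R, 0 < C1 /\ 0 < C2 /\
  forall (m d : nat) (t : dtree m), depth t = d ->
  forall l : nat, (1 <= l <= d)%N ->
    L1_level (dt_fun R t) l <=
      Num.sqrt ((C1 * d%:R) ^+ l * (C2 * ln (m%:R : R)) ^+ (l.-1)).
Proof.
have ln20 : 0 < ln (2 : R) by apply: ln_gt0; rewrite ltr1n.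
(* [8] is the constant of [L1_level_sqr_le]; [2 / ln 2] comes from bounding both [k] and [1] by
   [ln m / ln 2] when [m >= 2]. *)
exists 8, (2 / ln 2); split; first by []; split; first by rewrite divr_gt0.
move=> m _ t <- [//|l] _; rewrite succnK.
set L := L1_level _ _.
have L0 : 0 <= L by apply: sumr_ge0.
(* For [m <= 1] the logarithm cannot bound [k.+1]; but then either the level [l.+1] exceeds [m] and
   its mass is 0, or [l = 0] and the logarithm has exponent 0. *)
have [[m1 l0]|m1] : (m <= 1)%N /\ (0 < l)%N \/ ((1 < m)%N \/ l = 0%N).
  by case: (leqP m 1) => ?; [case: l {L L0} => [|l]|]; auto.
  rewrite [L]big1 ?sqrtr_ge0 // => S /eqP Sl.
  have lm : (l < m)%N by have := max_card (mem S); rewrite Sl card_ord.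
  by have := leq_trans lm m1; rewrite ltnS leqNgt l0.
have -> : L = Num.sqrt (L ^+ 2) by rewrite sqrtr_sqr ger0_norm.
apply: ler_wsqrtr.
pose k := trunc_log 2 m.
have mk : (m <= 2 ^ k.+1)%N by apply/ltnW/trunc_log_ltn.
apply: le_trans (L1_level_sqr_le R t l mk) _.
rewrite [in leRHS]exprS -[leRHS]mulrA ler_wpM2l ?mulr_ge0 //.
rewrite [leLHS]exprMn ler_wpM2l ?exprn_ge0 ?mulr_ge0 //.
case: m1 => [m1|->]; last by rewrite !expr0.
have lnm0 : ln 2 <= ln m%:R :> R by rewrite ler_ln ?posrE ?ltr0n ?ler_nat // ltnW.
have klnm : k%:R * ln 2 <= ln m%:R :> R.
  rewrite mulr_natl -lnXn // ler_ln ?posrE ?exprn_gt0 ?ltr0n //; last exact: ltnW.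
  by rewrite -natrX ler_nat trunc_logP // ltnW.
have klog : k.+1%:R <= 2 / ln 2 * ln m%:R :> R.
  by rewrite mulrAC ler_pdivlMr // -natr1 mulrDl mul1r; lra.
by rewrite lerXn2r ?nnegrE // (le_trans _ klog).
Qed.
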